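(* Let $A=[A_1,\dots,A_n]$ be an $m\times n$ real matrix with no zero columns and let $s$ be a positive integer. Then the matrix $$H(A)=\frac1{\mu(A)+1}\left[\frac{A_1}{A_1^TA_1},\frac{A_2}{A_2^TA_2},\dots,\frac{A_n}{A_n^TA_n}\right]$$ satisfies the condition $\mathbf{H}_{s,\infty}\left(\frac{s\mu(A)}{\mu(A)+1}\right)$.
   Context: The mutual incoherence of $A$ is $\mu(A)=\max_{1\le i\ne j\le n}\frac{|A_i^TA_j|}{A_i^TA_i}$ ($n\geq 2$). Condition $\mathbf{H}_{s,\infty}(\kappa)$ ($\kappa\ge0$) on $H\in\mathbb{R}^{m\times n}$: $\|x\|_\infty\le\|H^TAx\|_\infty+s^{-1}\kappa\|x\|_1$ for all $x\in\mathbb{R}^n$. *)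

(* Defs.v *)
From mathcomp Require Import all_boot all_order all_algebra.
From mathcomp Require Import reals normedtype.
Set Implicit Arguments.
Unset Strict Implicit.
Unset Printing Implicit Defensive.
Import Order.TTheory GRing.Theory Num.Theory.
Import numFieldNormedType.Exports.
Local Open Scope ring_scope.

Definition col_dot (R : realType) (m n : nat) (A : 'M[R]_(m, n)) (i j : 'I_n)
  : R := ((col i A)^T *m col j A) 0 0.

(* The default value 0 of the iterated max only matters when n < 2, since the
   values are nonnegative. *)
Definition mutual_incoherence (R : realType) (m n : nat) (A : 'M[R]_(m, n))
  : R :=
  \big[Num.max/0]_(p : 'I_n * 'I_n | p.1 != p.2)
    (`|col_dot A p.1 p.2| / col_dot A p.1 p.1).

Definition l1_norm (R : realType) (n : nat) (x : 'cV[R]_n) : R :=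
  \sum_(i < n) `|x i 0|.

(* On column vectors, `|x| is the entrywise maximum norm (mx_norm). *)
Definition cond_H_infty (R : realType) (m n : nat) (A : 'M[R]_(m, n)) (s : nat)
    (kappa : R) (H : 'M[R]_(m, n)) : Prop :=
  0 <= kappa /\
  forall x : 'cV[R]_n,
    `|x| <= `|H^T *m A *m x| + s%:R^-1 * kappa * l1_norm x.

Definition incoherence_matrix (R : realType) (m n : nat) (A : 'M[R]_(m, n))
  : 'M[R]_(m, n) :=
  (mutual_incoherence A + 1)^-1 *:
    \matrix_(i < m, j < n) (A i j / col_dot A j j).

(* Main.v *)
Require Import Defs.
From mathcomp Require Import all_boot all_order all_algebra.
From mathcomp Require Import reals normedtype.
From mathcomp Require Import ring lra.
Import Order.TTheory GRing.Theory Num.Theory.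
Import numFieldNormedType.Exports.
Local Open Scope ring_scope.

(** Write mu for the mutual incoherence, d i j for the inner product of columns
    i and j, and y = H^T A x. By [tr_incoherence_matrix_mulE], the matrix
    (mu + 1) H^T A has entries d i j / d i i. Since A has no zero column, its
    diagonal entries are 1; its off-diagonal entries are at most mu in absolute
    value by [norm_col_dot_ratio_le]. Isolating the diagonal term in the i-th
    row of (mu + 1) y therefore gives
      |x_i| <= (mu + 1) |y_i| + mu (|x|_1 - |x_i|),
    where the last term leaves out |x_i| because the row sum runs over j != i.
    Moving mu |x_i| to the left ([coord_le_row_pairing]) and dividing by mu + 1
    yields
      |x_i| <= |y_i| + mu / (mu + 1) |x|_1,
    and it remains to take the maximum over i. *)

Lemma norm_coord_le (R : realType) (n : nat) (x : 'cV[R]_n) (i : 'I_n) :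
  `|x i 0| <= `|x|.
Proof.
rewrite [leRHS]/Num.norm /= mx_normrE.
exact: (le_bigmax _ (fun ij : 'I_n * 'I_1 => `|x ij.1 ij.2|) (i, 0)).
Qed.

Lemma norm_le_coord (R : realType) (n : nat) (x : 'cV[R]_n) (c : R) :
  0 <= c -> (forall i, `|x i 0| <= c) -> `|x| <= c.
Proof.
move=> c0 xc; rewrite [leLHS]/Num.norm /= mx_normrE.
by apply: bigmax_le => // -[i j] _ /=; rewrite (ord1 j).
Qed.

Lemma col_dotE (R : realType) (m n : nat) (A : 'M[R]_(m, n)) (i j : 'I_n) :
  col_dot A i j = \sum_k A k i * A k j.
Proof. by rewrite /col_dot mxE; apply: eq_bigr => k _; rewrite !mxE. Qed.

Lemma col_dot_neq0 (R : realType) (m n : nat) (A : 'M[R]_(m, n)) (j : 'I_n) :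
  col j A != 0 -> col_dot A j j != 0.
Proof.
apply: contraNneq; rewrite col_dotE => A0.
apply/eqP/colP => k; rewrite !mxE; apply/eqP; rewrite -sqrf_eq0 expr2.
have sq_ge0 l : true -> 0 <= A l j * A l j by rewrite -expr2 sqr_ge0.
by move/eqP: A0; rewrite psumr_eq0 // => /allP/(_ k (mem_index_enum k)).
Qed.

Lemma col_dot_ge0 (R : realType) (m n : nat) (A : 'M[R]_(m, n)) (j : 'I_n) :
  0 <= col_dot A j j.
Proof. by rewrite col_dotE sumr_ge0 // => k _; rewrite -expr2 sqr_ge0. Qed.

Lemma mutual_incoherence_ge0 (R : realType) (m n : nat) (A : 'M[R]_(m, n)) :
  0 <= mutual_incoherence A.
Proof. exact: bigmax_ge_id. Qed.

Lemma norm_col_dot_ratio_le (R : realType) (m n : nat) (A : 'M[R]_(m, n))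
    (i j : 'I_n) :
  i != j -> `|col_dot A i j / col_dot A i i| <= mutual_incoherence A.
Proof.
move=> ij; rewrite normrM normfV (ger0_norm (col_dot_ge0 _ _ _ A i)).
exact: (le_bigmax_cond _ (fun p : 'I_n * 'I_n =>
  `|col_dot A p.1 p.2| / col_dot A p.1 p.1) (j := (i, j))).
Qed.

Lemma tr_incoherence_matrix_mulE (R : realType) (m n : nat)
    (A : 'M[R]_(m, n)) (i j : 'I_n) :
  ((incoherence_matrix A)^T *m A) i j =
  (mutual_incoherence A + 1)^-1 * (col_dot A i j / col_dot A i i).
Proof.
rewrite mxE col_dotE mulr_suml mulr_sumr.
by apply: eq_bigr => k _; rewrite !mxE; ring.
Qed.

(** The diagonal term of the pairing is x i itself, and the remaining sum is at
    most mu times the l1 norm of x without its i-th coordinate; the missing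
    mu |x i| is what raises the coefficient on the left from 1 to mu + 1. *)
Lemma coord_le_row_pairing (R : realType) (n : nat) (c x : 'I_n -> R) (mu : R)
    (i : 'I_n) :
  c i = 1 -> (forall j, j != i -> `|c j| <= mu) ->
  (mu + 1) * `|x i| <= `|\sum_j c j * x j| + mu * \sum_j `|x j|.
Proof.
move=> ci cmu.
rewrite [\sum_j c j * _](bigD1 i) //= [\sum_j `|_|](bigD1 i) //= ci mul1r.
set r := \sum_(j | j != i) c j * x j.
have r_le : `|r| <= mu * \sum_(j | j != i) `|x j|.
  rewrite mulr_sumr; apply: le_trans (ler_norm_sum _ _ _) _.
  by apply: ler_sum => j ji; rewrite normrM ler_wpM2r // cmu.
have xi_le : `|x i| <= `|x i + r| + `|r|.
  by rewrite -[X in `|X| <= _](addrK r); apply: ler_normB.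
rewrite mulrDl mul1r mulrDr; lra.
Qed.

Theorem mainTheorem9 (R : realType) (m n s : nat) (A : 'M[R]_(m, n))
    (hn : (2 <= n)%N) (hs : (0 < s)%N) (hA : forall j : 'I_n, col j A != 0) :
  cond_H_infty A s
    (s%:R * mutual_incoherence A / (mutual_incoherence A + 1))
    (incoherence_matrix A).
Proof.
have HAE := tr_incoherence_matrix_mulE _ _ _ A.
have ratio_le := norm_col_dot_ratio_le _ _ _ A.
have mu0 := mutual_incoherence_ge0 _ _ _ A.
move: HAE ratio_le mu0.
set mu := mutual_incoherence A; set HA := _^T *m A => HAE ratio_le mu0.
have mu1 : 0 < mu + 1 by rewrite ltr_wpDl.
split=> [|x]; first by rewrite divr_ge0 ?mulr_ge0 // ltW.
have -> : s%:R^-1 * (s%:R * mu / (mu + 1)) = mu / (mu + 1).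
  by rewrite !mulrA mulVf ?mul1r // pnatr_eq0 -lt0n.
have l1_ge0 : 0 <= l1_norm x by apply: sumr_ge0.
apply: norm_le_coord => [|i].
  by rewrite addr_ge0 // mulr_ge0 // divr_ge0 // ltW.
have row_i : \sum_j (col_dot A i j / col_dot A i i) * x j 0
    = (mu + 1) * (HA *m x) i 0.
  rewrite mxE mulr_sumr; apply: eq_bigr => j _.
  by rewrite HAE !mulrA divff ?mul1r // gt_eqF.
have row_le : (mu + 1) * `|x i 0| <= (mu + 1) * `|(HA *m x) i 0|
    + mu * l1_norm x.
  rewrite -[X in X * `|(HA *m x) i 0|](gtr0_norm mu1) -normrM -row_i.
  apply: (coord_le_row_pairing _ _ (fun j => col_dot A i j / col_dot A i i)
    (fun j => x j 0)) => [|j ji].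
    by rewrite divff // col_dot_neq0.
  by rewrite ratio_le // eq_sym.
apply: (@le_trans _ _ (`|(HA *m x) i 0| + mu / (mu + 1) * l1_norm x)).
  rewrite -(ler_pM2l mu1) mulrDr; apply: le_trans row_le _.
  by rewrite lerD2l !mulrA (mulrC _ mu) mulfK // gt_eqF.
by rewrite lerD2r norm_coord_le.
Qed.
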